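(* Let $G$ be a finite simple graph on $n$ vertices and let $0=\lambda_1\le\lambda_2\le\cdots\le\lambda_n$ be the Laplacian eigenvalues of $G$, so that $\lambda_n=\lambda_{\max}(L)$. Then $$\ell(\mathcal A(G))\ \ge\ \frac{\sum_{v\in V(G)}d(v)^2-|E(G)|\,\lambda_n}{4}.$$
   Context: Here $d(v)$ is the degree of $v$. Fix an orientation of the edges of $G=(V,E)$; the oriented incidence matrix $D$ is the $|V|\times|E|$ matrix with $D_{ve}=+1$ if $v$ is the head of $e$, $-1$ if $v$ is the tail of $e$, and $0$ otherwise. The Laplacian is $L=DD^{\mathsf T}$ (degree matrix minus adjacency matrix). The antisymmetric line graph $\mathcal A(G)$ is the signed graph with vertex set $E(G)$ and signed adjacency matrix $D^{\mathsf T}D-2I$ (nonzero entries are edges, with the entry $\pm1$ as sign). Switching a signed graph at a vertex reverses the signs of all edges incident to it; changing the orientation changes $\mathcal A(G)$ only by switching. The sign of a cycle is the product of its edge signs, and a signed graph is balanced if all its cycles are positive. The frustration index $\ell(\Sigma)$ of a signed graph $\Sigma$ is the minimum number of edges whose deletion makes $\Sigma$ balanced (equivalently, the minimum number of negative edges among all switchings of $\Sigma$); it is switching invariant. *)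

(* Defs.v *)
From HB Require Import structures.
From mathcomp Require Import all_boot all_order all_algebra.

Set Implicit Arguments.
Unset Strict Implicit.
Unset Printing Implicit Defensive.
Import Order.TTheory GRing.Theory Num.Theory.
Local Open Scope ring_scope.

Record sgraph (V : finType) := SGraph {
  adj :> rel V;
  adj_sym : symmetric adj;
  adj_irr : irreflexive adj
}.

Definition degree (V : finType) (G : sgraph V) (v : V) : nat :=
  #|[set w | adj G v w]|.

(* An edge is the two-element set of its endpoints. *)
Definition edges (V : finType) (G : sgraph V) : {set {set V}} :=
  [set [set p.1; p.2] | p in [set p : V * V | adj G p.1 p.2]].

Notation edge G := {e | e \in edges G}.

Lemma mem_edges (V : finType) (G : sgraph V) (x y : V) :
  ([set x; y] \in edges G) = adj G x y.
Proof.
apply/imsetP/idP => [[[a b]]|xy]; last by exists (x, y); rewrite ?inE.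
rewrite inE /= => ab eq.
have /set2P ax : a \in [set x; y] by rewrite eq set21.
have /set2P bx : b \in [set x; y] by rewrite eq set22.
case: ax bx => -> [] -> in ab *; rewrite ?adj_irr // in ab *.
by rewrite adj_sym.
Qed.

Record orientation (V : finType) (G : sgraph V) := Orientation {
  tail : edge G -> V;
  head : edge G -> V;
  orientationP : forall e, val e = [set tail e; head e]
}.

Lemma tail_head_adj (V : finType) (G : sgraph V) (o : orientation G) e :
  adj G (tail o e) (head o e).
Proof. by rewrite -mem_edges -orientationP (valP e). Qed.

Lemma tail_neq_head (V : finType) (G : sgraph V) (o : orientation G) e :
  tail o e != head o e.
Proof.
by apply/eqP => eq; have := tail_head_adj o e; rewrite eq adj_irr.
Qed.

(* Row i stands for the vertex enum_val i, column j for the edge enum_val j. *)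
Definition incidence (V : finType) (G : sgraph V) (o : orientation G) :
    'M[int]_(#|V|, #|{: edge G}|) :=
  \matrix_(i, j)
    if enum_val i == head o (enum_val j) then 1
    else if enum_val i == tail o (enum_val j) then - 1
    else 0.

Definition laplacian (V : finType) (G : sgraph V) (o : orientation G) :
    'M[int]_#|V| :=
  incidence o *m (incidence o)^T.

(* lambda lists the eigenvalues, with algebraic multiplicity, in nondecreasing
   order; its length is then forced to be the size of A. *)
Definition ordered_spectrum (R : rcfType) (n : nat) (A : 'M[R]_n)
    (lambda : seq R) : Prop :=
  sorted <=%R lambda /\ char_poly A = \prod_(x <- lambda) ('X - x%:P).

(* Only the values of [negative] on adjacent pairs are meaningful. *)
Record signed_graph (W : finType) := SignedGraph {
  underlying :> sgraph W;
  negative : rel W;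
  negative_sym : symmetric negative
}.

Definition edge_sign (W : finType) (S : signed_graph W) (x y : W) : int :=
  (-1) ^+ negative S x y.

Definition signed_adjacency (W : finType) (S : signed_graph W) :
    'M[int]_#|W| :=
  \matrix_(i, j) if adj S (enum_val i) (enum_val j)
                 then edge_sign S (enum_val i) (enum_val j) else 0.

(* A cycle is the sequence of its (distinct, at least three) vertices, the last
   one being adjacent to the first. *)
Definition is_cycle (W : finType) (G : sgraph W) (c : seq W) : bool :=
  [&& (2 < size c)%N, cycle (adj G) c & uniq c].

Definition cycle_sign (W : finType) (S : signed_graph W) (c : seq W) : int :=
  \prod_(x <- c) edge_sign S x (next c x).

(* The bound on the length makes balance decidable and excludes no cycle: see
   [balancedP]. *)
Definition balanced (W : finType) (S : signed_graph W) : bool :=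
  [forall k : 'I_(#|W|.+1), forall c : k.-tuple W,
     is_cycle S c ==> (cycle_sign S c == 1)].

Lemma balancedP (W : finType) (S : signed_graph W) :
  reflect (forall c : seq W, is_cycle S c -> cycle_sign S c = 1) (balanced S).
Proof.
apply: (iffP 'forall_forallP) => [bal c cyc|bal k c]; last first.
  by apply/implyP => /bal ->.
have uc : (size c < #|W|.+1)%N.
  by case/and3P: cyc => _ _ /card_uniqP <-; rewrite ltnS max_card.
by have /implyP/(_ cyc)/eqP := bal (Ordinal uc) (in_tuple c).
Qed.

Section DeleteEdges.
Variables (W : finType) (S : signed_graph W) (F : {set {set W}}).

Let del_adj : rel W := [rel x y | adj S x y && ([set x; y] \notin F)].

Fact del_adj_sym : symmetric del_adj.
Proof. by move=> x y; rewrite /del_adj /= adj_sym setUC. Qed.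

Fact del_adj_irr : irreflexive del_adj.
Proof. by move=> x; rewrite /del_adj /= adj_irr. Qed.

Definition delete_edges : signed_graph W :=
  SignedGraph (SGraph del_adj_sym del_adj_irr) (@negative_sym W S).

End DeleteEdges.

Definition balancing (W : finType) (S : signed_graph W) (F : {set {set W}}) :
    bool :=
  (F \subset edges S) && balanced (delete_edges S F).

Definition frustration_index (W : finType) (S : signed_graph W) : nat :=
  #|[arg min_(F < edges S | balancing S F) #|F|]|.

Lemma balancing_edges (W : finType) (S : signed_graph W) :
  balancing S (edges S).
Proof.
rewrite /balancing subxx; apply/balancedP => -[|x [|y c]] // /and3P[_ /=].
by rewrite mem_edges andbN.
Qed.

(* The arg min above is a genuine minimum. *)
Lemma frustration_indexP (W : finType) (S : signed_graph W) :
  (exists2 F, balancing S F & #|F| = frustration_index S) /\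
  (forall F, balancing S F -> (frustration_index S <= #|F|)%N).
Proof.
rewrite /frustration_index; case: arg_minnP => [|F balF minF].
  exact: balancing_edges.
by split=> [|F' /minF //]; exists F.
Qed.

Section AntisymmetricLineGraph.
Variables (V : finType) (G : sgraph V) (o : orientation G).

Definition line_matrix : 'M[int]_#|{: edge G}| :=
  (incidence o)^T *m incidence o - 2%:M.

Let entry (e f : edge G) : int := line_matrix (enum_rank e) (enum_rank f).

Fact line_matrix_sym : line_matrix^T = line_matrix.
Proof. by rewrite linearB /= trmx_mul trmxK tr_scalar_mx. Qed.

Let entry_sym e f : entry e f = entry f e.
Proof. by rewrite /entry -[in LHS]line_matrix_sym mxE. Qed.

Let inc (v : V) (e : edge G) : int :=
  if v == head o e then 1 else if v == tail o e then - 1 else 0.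

Let entryE e f : entry e f =
  inc (head o e) f - inc (tail o e) f - 2%:R *+ (e == f).
Proof.
rewrite /entry !mxE (inj_eq enum_rank_inj); congr (_ - _).
transitivity (\sum_v inc v e * inc v f).
  rewrite [RHS](reindex _ (onW_bij _ (@enum_val_bij V))) /=.
  by apply: eq_bigr => i _; rewrite !mxE !enum_rankK.
rewrite (bigD1 (head o e)) //= (bigD1 (tail o e)) ?tail_neq_head //=.
rewrite big1 => [|v /andP[vh vt]]; last first.
  by rewrite {1}/inc (negPf vh) (negPf vt) mul0r.
by rewrite {1 3}/inc !eqxx (negPf (tail_neq_head o e)) mul1r mulN1r addr0.
Qed.

Let entry_diag e : entry e e = 0.
Proof. by rewrite entryE /inc !eqxx (negPf (tail_neq_head o e)). Qed.

Let line_adj : rel (edge G) := [rel e f | entry e f != 0].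

Fact line_adj_sym : symmetric line_adj.
Proof. by move=> e f; rewrite /line_adj /= entry_sym. Qed.

Fact line_adj_irr : irreflexive line_adj.
Proof. by move=> e; rewrite /line_adj /= entry_diag eqxx. Qed.

Let line_neg : rel (edge G) := [rel e f | entry e f < 0].

Fact line_neg_sym : symmetric line_neg.
Proof. by move=> e f; rewrite /line_neg /= entry_sym. Qed.

Definition antisymmetric_line_graph : signed_graph (edge G) :=
  SignedGraph (SGraph line_adj_sym line_adj_irr) line_neg_sym.

Lemma antisymmetric_line_graphE :
  signed_adjacency antisymmetric_line_graph = line_matrix.
Proof.
apply/matrixP => i j; rewrite mxE /edge_sign /= /line_adj /line_neg /=.
have -> : line_matrix i j = entry (enum_val i) (enum_val j).
  by rewrite /entry !enum_valK.
move: (enum_val i) (enum_val j) => e f.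
case: (eqVneq e f) => [->|nef]; first by rewrite entry_diag eqxx.
have ends : ~~ ((head o e \in [set tail o f; head o f]) &&
                (tail o e \in [set tail o f; head o f])).
  apply: contra nef; rewrite -sub1set -[X in _ && X]sub1set -subUset setUC.
  rewrite -!(orientationP o) => sub; apply/eqP/val_inj/eqP.
  by rewrite eqEcard sub !(orientationP o) !cards2 !tail_neq_head.
move: ends; rewrite entryE (negPf nef) mulr0n subr0 /inc !inE.
by do 2![case: (_ == head o f)]; do 2?[case: (_ == tail o f)].
Qed.

End AntisymmetricLineGraph.

(* Main.v *)
(* Write D for the incidence matrix and let F be a minimum set of edges whose
   deletion balances A(G). By Harary's theorem some x in {1, -1}^E satisfies
   sign(e, f) = x_e x_f for every edge ef of A(G) outside F. In the expansion of
   |D x|^2 = x^T D^T D x every entry of D^T D then contributes its absolute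
   value, except that each edge in F costs at most 4. The absolute value at
   (e, f) is the number of common endpoints of e and f, so these sum to
   sum_v d(v)^2. On the other hand |D x|^2 <= lambda_n |x|^2 = lambda_n |E|. *)

Require Import Defs.
From mathcomp Require Import all_boot all_order all_algebra.
From mathcomp Require Import complex zify lra.
Import Order.TTheory GRing.Theory Num.Theory.
Local Open Scope ring_scope.
Local Open Scope sesquilinear_scope.

(** * Rayleigh bounds for Hermitian, symmetric and Gram matrices *)

(** The rows of the unitary [P] are eigenvectors: writing [y] as [z *m P] turns the two forms into
    the sums of d_i |z_i|^2 and of |z_i|^2, which are compared term by term. *)
Lemma rayleigh_hermitian (C : numClosedFieldType) (n : nat) (A : 'M[C]_n)
    (a : C) (y : 'rV[C]_n) :
  A \is hermsymmx -> (forall x, root (char_poly A) x -> x <= a) ->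
  (y *m A *m y ^t*) 0 0 <= a * (y *m y ^t*) 0 0.
Proof.
move=> hA le_a.
have [P_unitary P_unit] := (spectral_unitarymx A, spectral_unit A).
have /orthomx_spectralP := hermitian_normalmx hA.
set P := spectralmx A in P_unitary P_unit *; set d := spectral_diag A => defA.
have PA : P *m A = diag_mx d *m P by rewrite {1}defA !mulmxA mulmxV // mul1mx.
have d_le i : d 0 i <= a.
  apply: le_a; rewrite -eigenvalue_root_char; apply/eigenvalueP.
  exists (row i P).
    by rewrite -row_mul PA mul_diag_mx; apply/rowP => j; rewrite !mxE.
  (* A zero row would make the determinant of [P] vanish. *)
  apply: contraTneq P_unit => Pi0; rewrite unitmxE -det_tr.
  rewrite (expand_det_col _ i) big1 ?unitr0 // => j _.
  by move/rowP/(_ j): Pi0; rewrite !mxE => ->; rewrite mul0r.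
have [z yE] : exists z, y = z *m P by exists (y *m invmx P); rewrite mulmxKV.
have PP : P *m P ^t* = 1%:M by apply/unitarymxP.
have zP : (z *m P) ^t* = P ^t* *m z ^t* by rewrite trmx_mul map_mxM.
have -> : y *m A *m y ^t* = z *m diag_mx d *m z ^t*.
  rewrite yE zP -(mulmxA z) PA !mulmxA -(mulmxA (z *m diag_mx d)) PP.
  by rewrite mulmx1.
have -> : y *m y ^t* = z *m z ^t*.
  by rewrite yE zP !mulmxA -(mulmxA z) PP mulmx1.
rewrite !mxE mulr_sumr ler_sum // => i _.
rewrite mul_mx_diag !mxE (mulrC (z 0 i)) -mulrA ler_wpM2r //.
exact: mul_conjC_ge0.
Qed.

(** Over the complexification the matrix becomes Hermitian, and its characteristic roots are still
    the images of the elements of [s]. *)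
Lemma rayleigh_symmetric (R : rcfType) (n : nat) (A : 'M[R]_n) (s : seq R)
    (a : R) (y : 'rV[R]_n) :
  A^T = A -> char_poly A = \prod_(x <- s) ('X - x%:P) ->
  {in s, forall x, x <= a} ->
  (y *m A *m y^T) 0 0 <= a * (y *m y^T) 0 0.
Proof.
move=> symA chA le_a; pose toC := real_complex R.
have conjR m p (B : 'M[R]_(m, p)) :
    (map_mx toC B) ^t* = map_mx toC B^T.
  by apply/matrixP => i j; rewrite !mxE conj_Creal // complex_real.
have hA : map_mx toC A \is hermsymmx.
  by apply/is_hermitianmxP; rewrite expr0 scale1r conjR symA.
have spec x : root (char_poly (map_mx toC A)) x -> x <= toC a.
  rewrite -map_char_poly chA rmorph_prod /=.
  under eq_bigr do rewrite rmorphB /= map_polyX map_polyC.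
  rewrite -(big_map toC xpredT (fun x => 'X - x%:P)) root_prod_XsubC.
  by case/mapP => b /le_a ba ->; rewrite lecR.
have := rayleigh_hermitian _ _ _ _ (map_mx toC y) hA spec.
by rewrite conjR -!map_mxM !mxE -rmorphM lecR.
Qed.

Local Close Scope sesquilinear_scope.

(** The spectrum is that of [B *m B^T], whereas the bound concerns [B^T *m B], a matrix of another
    size. Applying the Rayleigh bound to [B *m x] gives |w|^2 <= a |B x|^2 for w = B^T B x, and x^T
    w = |B x|^2 leads back to [x]. *)
Lemma gram_rayleigh (R : rcfType) (m n : nat) (B : 'M[R]_(n, m)) (s : seq R)
    (a : R) (x : 'cV[R]_m) :
  (0 < n)%N -> char_poly (B *m B^T) = \prod_(x <- s) ('X - x%:P) ->
  {in s, forall x, x <= a} ->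
  ((B *m x)^T *m (B *m x)) 0 0 <= a * (x^T *m x) 0 0.
Proof.
move=> n_gt0 chBB le_a.
have norm_ge0 k (u : 'cV[R]_k) : 0 <= (u^T *m u) 0 0.
  by rewrite mxE sumr_ge0 // => i _; rewrite mxE -expr2 sqr_ge0.
have ray (y : 'cV[R]_n) :
    ((B^T *m y)^T *m (B^T *m y)) 0 0 <= a * (y^T *m y) 0 0.
  have := rayleigh_symmetric _ _ _ _ _ y^T _ chBB le_a.
  by rewrite !trmx_mul !trmxK !mulmxA; apply.
(* A basis vector e, available because [n] is positive, gives 0 <= |B^T e|^2 <= a. *)
have a_ge0 : 0 <= a.
  have := le_trans (norm_ge0 _ _) (ray (delta_mx (Ordinal n_gt0) 0)).
  by rewrite trmx_delta mul_delta_mx mxE !eqxx mulr1.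
set w := B^T *m (B *m x).
have xw : x^T *m w = (B *m x)^T *m (B *m x) by rewrite /w trmx_mul !mulmxA.
have wx : w^T *m x = (B *m x)^T *m (B *m x).
  by rewrite -[LHS]trmxK trmx_mul trmxK xw trmx_mul trmxK.
have := ray (B *m x); rewrite -/w.
move: a_ge0; rewrite le_eqVlt => /predU1P[<-|a_gt0] le_w.
  (* For a = 0 the bound on |w|^2 forces w = 0, whence |B x|^2 = x^T w = 0. *)
  suff -> : (B *m x)^T *m (B *m x) = 0 by rewrite mxE mul0r.
  suff w0 : w = 0 by rewrite -xw w0 mulmx0.
  apply/colP => i; move: le_w; rewrite mul0r mxE => le_w.
  have sqr0 k : true -> 0 <= w^T 0 k * w k 0.
    by rewrite mxE -expr2 sqr_ge0.
  have /eqP := le_anti (introT andP (conj le_w (sumr_ge0 _ sqr0))).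
  rewrite psumr_eq0 // => /allP/(_ i (mem_index_enum i)).
  by rewrite !mxE mulf_eq0 orbb => /eqP.
(* Expand 0 <= |a x - w|^2 and use x^T w = |B x|^2 and |w|^2 <= a |B x|^2. *)
have := norm_ge0 _ (a *: x - w).
have -> : (a *: x - w)^T = a *: x^T - w^T by rewrite linearB linearZ.
rewrite mulmxBl !mulmxBr -!scalemxAl -!scalemxAr xw wx.
move: (x^T *m x) (w^T *m w) ((B *m x)^T *m (B *m x)) le_w => p r q le_r.
by rewrite !mxE => ge0; rewrite -(ler_pM2l a_gt0); lra.
Qed.

(** * Signs of closed walks, and switching functions of balanced signed graphs *)

Lemma not_uniq_split (T : eqType) (s : seq T) :
  ~~ uniq s -> exists x p q r, s = p ++ x :: q ++ x :: r.
Proof.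
elim: s => [//|y s IHs] /=; rewrite negb_and negbK => /orP[|/IHs].
  by case/splitPr => q r; exists y, [::], q, r.
by case=> x [p [q [r ->]]]; exists x, (y :: p), q, r.
Qed.

Section Walks.
Variables (W : finType) (S : signed_graph W).

Fixpoint walk_negative (x : W) (p : seq W) : bool :=
  if p is y :: p' then negative S x y (+) walk_negative y p' else false.

Lemma walk_negative_cat x p q :
  walk_negative x (p ++ q) =
  walk_negative x p (+) walk_negative (last x p) q.
Proof. by elim: p x => [|y p IHp] x //=; rewrite IHp addbA. Qed.

Lemma walk_negative_cycle x p : uniq (x :: p) ->
  cycle_sign S (x :: p) = (-1) ^+ walk_negative x (rcons p x).
Proof.
move=> uniq_c; have walkE q y : (-1) ^+ walk_negative y q =
    \prod_(0 <= i < size q) edge_sign S (nth x (y :: q) i) (nth x q i).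
  elim: q y => [|z q IHq] y /=; first by rewrite big_nil.
  by rewrite big_nat_recl //= signr_addb IHq.
rewrite walkE size_rcons /cycle_sign (big_nth x).
apply: eq_big_nat => i /andP[_ lti].
rewrite next_nth mem_nth // index_uniq // -cats1 -cat_cons !nth_cat lti.
(* At the closing edge the default value [x] of [nth] is the vertex to which the cycle returns. *)
case: ltnP => // leip; rewrite (@nth_default _ x p) //.
by case: (i - size p)%N => [|[]].
Qed.

(** Induction on the length: a repeated vertex [z] cuts the walk into two shorter closed walks,
    whose parities add up. *)
Lemma balanced_closed_walk x p : balanced S ->
  path (adj S) x p -> last x p = x -> walk_negative x p = false.
Proof.
move=> /balancedP bal; have [m] := ubnP (size p).
elim: m => // m IHm in x p *; rewrite ltnS => lepm pathp lastp.
have [uniqp|] := boolP (uniq p); last first.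
  case/not_uniq_split=> z [p1 [p2 [p3 defp]]].
  move: pathp lastp lepm; rewrite {}defp size_cat /= size_cat /= cat_path.
  rewrite last_cat /= cat_path last_cat /= => /and5P[path1 z1 path2 z2 path3].
  move=> lastp lepm; rewrite -cat_rcons walk_negative_cat last_rcons.
  rewrite -cat_rcons walk_negative_cat last_rcons.
  rewrite [walk_negative z (rcons p2 z)]IHm ?last_rcons //; last first.
  - by rewrite rcons_path path2.
  - by rewrite size_rcons; lia.
  have := walk_negative_cat x (rcons p1 z) p3; rewrite last_rcons => <-.
  rewrite IHm //.
  - by rewrite size_cat size_rcons; lia.
  - by rewrite cat_path rcons_path path1 z1 last_rcons.
  - by rewrite last_cat last_rcons.
case/lastP: p => [//|p y] in lepm pathp lastp uniqp *.
rewrite last_rcons in lastp; rewrite {y}lastp in lepm pathp uniqp *.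
have uniqc : uniq (x :: p) by rewrite /= -rcons_uniq.
(* Without repetition the walk is a loop, excluded by irreflexivity, an edge walked back and forth,
   whose two signs cancel, or a genuine cycle. *)
case: p => [|y [|z p]] in lepm pathp uniqp uniqc *.
- by move: pathp; rewrite /= adj_irr.
- by rewrite /= negative_sym addbF addbb.
have /bal : is_cycle S [:: x, y, z & p] by rewrite /is_cycle uniqc andbT.
by rewrite walk_negative_cycle //; case: walk_negative.
Qed.

(* A walk lifts to one that changes sheet exactly when its sign is negative, so
   balance means that the two sheets over x are disconnected, and the sheet
   reached from a root of the component is the switching function. *)
Definition double_cover : rel (W * bool) :=
  [rel u v | adj S u.1 v.1 && (v.2 == u.2 (+) negative S u.1 v.1)].

Lemma double_cover_sym : symmetric double_cover.
Proof.
move=> [x b] [y c].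
rewrite /double_cover /= [adj S x y]adj_sym [negative S x y]negative_sym.
by case: (adj S y x); case: b; case: c; case: negative.
Qed.

Lemma double_cover_path u p : path double_cover u p ->
  path (adj S) u.1 (map fst p) /\
  (last u p).2 = u.2 (+) walk_negative u.1 (map fst p).
Proof.
elim: p u => [|v p IHp] u /=; first by rewrite addbF.
by case/andP=> /andP[-> /eqP v2] /IHp[-> ->]; rewrite v2 addbA.
Qed.

Lemma double_cover_lift x b p : path (adj S) x p ->
  connect double_cover (x, b) (last x p, b (+) walk_negative x p).
Proof.
elim: p => [|y p IHp] /= in x b *; first by rewrite addbF connect0.
case/andP=> xy pathp.
have := IHp y (b (+) negative S x y) pathp; rewrite -addbA.
by apply: connect_trans; apply: connect1; rewrite /double_cover /= xy eqxx.
Qed.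

Lemma balanced_switching : balanced S ->
  exists s : W -> bool,
    forall x y, adj S x y -> negative S x y = s x (+) s y.
Proof.
move=> bal.
have cover_sym := sym_connect_sym double_cover_sym.
have adjC : connect_sym (adj S) := sym_connect_sym (@adj_sym W S).
have sheets x (b : bool) : connect double_cover (x, b) (x, ~~ b) = false.
  apply/negP => /connectP[p /double_cover_path[pathp lastb] lastp].
  move: lastb; rewrite -lastp balanced_closed_walk //=; first by case: (b).
  by rewrite (last_map fst p (x, b)) -lastp.
pose s x := connect double_cover (fingraph.root (adj S) x, false) (x, true).
have sE x b :
    connect double_cover (fingraph.root (adj S) x, false) (x, b) -> s x = b.
  rewrite /s; case: b => [//|conn0]; apply/negP => conn1.
  by have := sheets x false; rewrite (connect_trans _ conn1) // cover_sym.
exists s => x y xy; set r := fingraph.root (adj S) x.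
have rE : r = fingraph.root (adj S) y by apply/(fingraph.rootP adjC)/connect1.
have /connectP[q pathq lastq] : connect (adj S) r x.
  by rewrite adjC connect_root.
have conn := double_cover_lift _ false _ pathq; rewrite -lastq in conn.
(* The path [q] to [x], prolonged by the edge to [y], lifts to the sheets reached over [x] and [y];
   these differ by the sign of that edge. *)
rewrite (sE _ _ conn) (sE y (walk_negative r q (+) negative S x y)) ?addKb //.
rewrite -rE; apply: connect_trans conn (connect1 _).
by rewrite /double_cover /= xy eqxx.
Qed.

End Walks.

(** * Degrees, common endpoints and the entries of the Gram matrix *)

(** The map from w to {v, w} is a bijection from the neighbours of [v] to the edges through [v]. *)
Lemma degreeE (V : finType) (G : sgraph V) (v : V) :
  degree G v = (\sum_(e : edge G) (v \in val e))%N.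
Proof.
rewrite -big_mkcond sum1_card /= -(card_imset _ val_inj).
rewrite /degree -(@card_in_imset _ _ (fun w => [set v; w])); last first.
  move=> w w'; rewrite !inE => vw vw' eqww'.
  have : w \in [set v; w'] by rewrite -eqww' set22.
  by case/set2P=> // wv; rewrite wv adj_irr in vw.
apply: eq_card => X; apply/imsetP/imsetP => [[w]|[e]].
  rewrite inE => vw ->; have vwE : [set v; w] \in edges G by rewrite mem_edges.
  by exists (exist (fun e => e \in edges G) _ vwE) => //; apply: set21.
move=> ve ->; have: v \in val e := ve; case/imsetP: (valP e) => -[a b].
rewrite inE /= => ab -> => /set2P[]->.
  by exists b; rewrite ?inE.
by exists a; rewrite 1?setUC // inE adj_sym.
Qed.

(** Both sides count the triples (v, e, f) with v an endpoint of both e and f. *)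
Lemma sum_degree_square (V : finType) (G : sgraph V) :
  (\sum_v degree G v ^ 2 =
   \sum_(e : edge G) \sum_(f : edge G) #|val e :&: val f|)%N.
Proof.
under eq_bigr do rewrite degreeE -mulnn big_distrlr /=.
rewrite exchange_big; apply: eq_bigr => e _.
rewrite exchange_big; apply: eq_bigr => f _.
rewrite -sum1_card [RHS]big_mkcond; apply: eq_bigr => v _.
by rewrite inE /=; do 2!case: (v \in _).
Qed.

Lemma edge_common_uniq (V : finType) (G : sgraph V) (o : orientation G)
    (e f : edge G) (v w : V) :
  e != f -> v \in val e :&: val f -> w \in val e :&: val f -> v = w.
Proof.
move=> nef /setIP[ve vf] /setIP[we wf]; apply: contraNeq nef => nvw.
have spanE (g : edge G) : v \in val g -> w \in val g -> val g = [set v; w].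
  move=> vg wg; apply/esym/eqP; rewrite eqEcard subUset !sub1set vg wg /=.
  by rewrite (orientationP o) !cards2 nvw; case: (_ == _).
by apply/eqP/val_inj; rewrite (spanE e ve we) (spanE f vf wf).
Qed.

Lemma incidence_norm (V : finType) (G : sgraph V) (o : orientation G) i j :
  `|incidence o i j| = (enum_val i \in val (enum_val j))%:Z.
Proof.
by rewrite mxE (orientationP o) !inE orbC; do 2!case: (_ == _).
Qed.

(** No cancellation occurs in the entry: on the diagonal the summands are squares, and off the
    diagonal at most one is nonzero, since distinct edges share at most one vertex. *)
Lemma gram_incidence_norm (V : finType) (G : sgraph V) (o : orientation G)
    i j :
  #|val (enum_val i) :&: val (enum_val j)|%:Z <=
  `|((incidence o)^T *m incidence o) i j|.
Proof.
set D := incidence o.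
have -> : #|val (enum_val i) :&: val (enum_val j)|%:Z =
          \sum_k `|D k i * D k j|.
  rewrite -sum1_card [(\sum_(_ in _) _)%N]big_mkcond.
  rewrite (reindex _ (onW_bij _ (@enum_val_bij V))) -natz natr_sum /=.
  apply: eq_bigr => k _; rewrite normrM !incidence_norm inE.
  by do 2!case: (_ \in _).
rewrite mxE; under [X in `|X|]eq_bigr do rewrite mxE.
have [<-|nij] := eqVneq i j.
  rewrite [X in _ <= X]ger0_norm; last first.
    by apply: sumr_ge0 => k _; rewrite -expr2 sqr_ge0.
  by apply: ler_sum => k _; rewrite ger0_norm // -expr2 sqr_ge0.
have common k : D k i * D k j != 0 ->
    enum_val k \in val (enum_val i) :&: val (enum_val j).
  rewrite -normr_eq0 normrM !incidence_norm inE.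
  by do 2!case: (_ \in _).
have [k0 nz0|all0] := pickP (fun k => D k i * D k j != 0); last first.
  by rewrite big1 // => k _; apply/eqP; rewrite normr_eq0 -[_ == _]negbK all0.
have others k : k != k0 -> D k i * D k j = 0.
  move=> nk; apply: contraNeq nk => /common ck; apply/eqP/enum_val_inj.
  by apply: edge_common_uniq (common _ nz0); rewrite ?(inj_eq enum_val_inj).
rewrite (bigD1 k0) // [X in _ <= `|X|](bigD1 k0) //= big1; last first.
  by move=> k /others ->; rewrite normr0.
by rewrite big1 ?addr0 // => k /others.
Qed.

(** * The quadratic form at a switching vector and its loss on the deleted edges *)

Lemma card_ordered_pairs_le (W : finType) (G : sgraph W) (F : {set {set W}}) :
  F \subset edges G ->
  (\sum_(e : W) \sum_(f : W) ([set e; f] \in F) <= 2 * #|F|)%N.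
Proof.
move=> subF; rewrite pair_big /= -big_mkcond /=.
rewrite (partition_big (fun p : W * W => [set p.1; p.2]) (mem F)) //=.
rewrite mulnC -sum_nat_const leq_sum // => X /(subsetP subF)/imsetP[[a b]].
rewrite inE /= => ab ->; rewrite sum1_card.
apply: leq_trans (_ : #|[set (a, b); (b, a)]| <= 2)%N; last first.
  by rewrite cards2; case: (_ != _).
apply/subset_leq_card/subsetP => -[c d]; rewrite !inE /=.
rewrite unfold_in /= => /andP[_ /eqP cd].
have cdG : adj G c d by rewrite -mem_edges cd mem_edges.
have /set2P[] : c \in [set a; b] by rewrite -cd set21.
all: move=> cE; rewrite cE in cdG cd *.
all: have /set2P[] : d \in [set a; b] by rewrite -cd set22.
all: by move=> dE; rewrite dE ?adj_irr // ?eqxx ?orbT // in cdG *.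
Qed.

Lemma sum_enum_val (T : finType) (g : T -> nat) :
  (\sum_x g x)%N%:Z = \sum_(i < #|T|) (g (enum_val i))%:Z.
Proof.
rewrite (reindex _ (onW_bij _ (@enum_val_bij T))) -natz natr_sum /=.
by apply: eq_bigr => i _; rewrite natz.
Qed.

Lemma frustrated_quadratic_form (V : finType) (G : sgraph V)
    (o : orientation G) :
  exists2 x : 'cV[int]_#|{: edge G}|, forall i, x i 0 ^+ 2 = 1 &
  (\sum_v degree G v ^ 2)%N%:Z <=
    ((incidence o *m x)^T *m (incidence o *m x)) 0 0 +
    4 * (frustration_index (antisymmetric_line_graph o))%:Z.
Proof.
set S := antisymmetric_line_graph o.
have [[F /andP[subF balF] <-] _] := frustration_indexP S.
have [s delP] := balanced_switching _ _ balF.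
have sP e f : adj S e f -> [set e; f] \notin F ->
    negative S e f = s e (+) s f.
  by move=> ef nF; apply: delP; apply/andP.
(* The witness is the switching function of the balanced graph left after deleting [F], written with
   values 1 and -1. *)
exists (\col_j (-1) ^+ s (enum_val j)) => [i|].
  by rewrite mxE -exprM mulnC exprM sqrrN expr1n.
set x := \col_j _; set M := (incidence o)^T *m incidence o.
have ME : M = signed_adjacency S + 2%:M.
  by rewrite antisymmetric_line_graphE subrK.
(* Outside [F] the vector makes each entry count with its absolute value; inside [F] an entry may
   count as -1 instead of 1, a loss of 2. *)
have entry_ge i j : #|val (enum_val i) :&: val (enum_val j)|%:Z <=
    x i 0 * (M i j * x j 0) + 2 * ([set enum_val i; enum_val j] \in F)%:Z.
  apply: le_trans (gram_incidence_norm _ _ o i j) _.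
  rewrite -/M ME !mxE /edge_sign.
  have [<-|nij] := eqVneq i j.
    rewrite adj_irr add0r mulrCA -expr2 -exprM mulnC exprM sqrrN expr1n.
    by case: (_ \in F).
  rewrite mulr0n addr0; case: ifP => [Sij|_]; last first.
    by rewrite normr0 mul0r mulr0 add0r; case: (_ \in F).
  rewrite normr_sign; have [_|/(sP _ _ Sij)->] := boolP (_ \in F).
    by case: (s _); case: (s _); case: (negative _ _ _).
  by case: (s _); case: (s _).
have -> : (incidence o *m x)^T *m (incidence o *m x) = x^T *m (M *m x).
  by rewrite trmx_mul !mulmxA.
have -> : (x^T *m (M *m x)) 0 0 = \sum_i \sum_j x i 0 * (M i j * x j 0).
  rewrite mxE; apply: eq_bigr => i _.
  by rewrite mxE [(M *m x) i 0]mxE mulr_sumr.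
have sum_edges (g : edge G -> nat) :
    (\sum_e g e)%N%:Z = \sum_(i < #|{: edge G}|) (g (enum_val i))%:Z.
  exact: sum_enum_val.
have pairs : \sum_(i < #|{: edge G}|) \sum_(j < #|{: edge G}|)
    ([set enum_val i; enum_val j] \in F)%:Z <= 2 * #|F|%:Z.
  have := card_ordered_pairs_le _ _ _ subF.
  rewrite -lez_nat PoszM sum_edges => le_pairs; apply: le_trans le_pairs.
  by apply: ler_sum => i _; rewrite sum_edges.
rewrite sum_degree_square sum_edges.
apply: le_trans (_ : _ <= \sum_(i < #|{: edge G}|)
  \sum_(j < #|{: edge G}|) (x i 0 * (M i j * x j 0) +
   2 * ([set enum_val i; enum_val j] \in F)%:Z)) _.
  by apply: ler_sum => i _; rewrite sum_edges; apply: ler_sum.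
under eq_bigr do rewrite big_split /= -[\sum_i 2 * _]mulr_sumr.
rewrite big_split /= -[\sum_i 2 * _]mulr_sumr lerD2l.
(* A loss of 2 for each of the two ordered pairs of an edge in [F]. *)
by rewrite (_ : 4 = 2 * 2) // -mulrA ler_pM2l.
Qed.

(** * The largest eigenvalue and the final estimate *)

Lemma ordered_spectrum_le_last (R : rcfType) (n : nat) (A : 'M[R]_n)
    (s : seq R) :
  ordered_spectrum A s -> {in s, forall x, x <= s`_n.-1}.
Proof.
case=> sorted_s chA x xs.
(* The degree of the characteristic polynomial fixes the length, so index [n.-1] is the last entry
   and not a default value. *)
have size_s : size s = n.
  by have := size_char_poly A; rewrite chA size_prod_XsubC => -[].
have lt_index : (index x s < n)%N by rewrite -size_s index_mem.
rewrite -(nth_index 0 xs) sorted_leq_nth ?inE ?size_s //; first exact: le_trans.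
  by rewrite prednK // (leq_ltn_trans _ lt_index).
by rewrite -ltnS prednK // (leq_ltn_trans _ lt_index).
Qed.

Theorem theorem10 (R : rcfType) (V : finType) (n : nat) (G : sgraph V)
    (o : orientation G) (lambda : seq R) :
  (0 < n)%N ->
  #|V| = n ->
  ordered_spectrum (map_mx intr (laplacian o)) lambda ->
  (((\sum_(v : V) degree G v ^ 2)%N)%:R - #|edges G|%:R * lambda`_n.-1) / 4%:R
    <= (frustration_index (antisymmetric_line_graph o))%:R :> R.
Proof.
move=> n_gt0 Vn spec; rewrite -Vn in n_gt0 *.
have [x x_sqr le_form] := frustrated_quadratic_form _ _ o.
have le_last := ordered_spectrum_le_last _ _ _ _ spec.
have := gram_rayleigh _ _ _ (map_mx intr (incidence o)) lambda _
  (map_mx intr x) n_gt0.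
rewrite map_trmx -map_mxM => /(_ _ spec.2 le_last).
rewrite -map_mxM map_trmx -map_mxM map_trmx -map_mxM.
rewrite [leLHS]mxE [X in _ * X]mxE.
(* The entries of [x] square to 1, so |x|^2 is the number of edges. *)
have -> : (x^T *m x) 0 0 = #|edges G|%:Z.
  rewrite mxE (eq_bigr (fun=> 1)) => [|i _]; last by rewrite mxE -expr2.
  by rewrite sumr_const card_ord card_sig natz.
rewrite /= -pmulrn => le_rayleigh.
move: le_form; rewrite -(ler_int R) intrD intrM -!pmulrn => le_form.
rewrite ler_pdivrMr // lerBlDr (le_trans le_form) // addrC mulrC.
by rewrite lerD2l mulrC.
Qed.
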